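(* Let $\mathbf a$ be a mask. The barycentric scheme $S$ associated to $\mathbf a$ is convergent on every Hadamard space if and only if there are $C\ge0$ and $\gamma<1$ such that for every Hadamard space $(X,d)$, $$D_\infty(S^nx)\le C\gamma^nD_\infty(x)\quad\text{for all }x\in\ell^\infty(\mathbb Z^s,X),\ n\in\mathbb N_0,$$ where $D_\infty(x)=\sup\{d(x_i,x_j): i,j\in\mathbb Z^s,\ \|i-j\|_\infty\le1\}$.
   Context: Hadamard space: complete metric space $(X,d)$ such that for any $x_0,x_1\in X$ there is $y$ with $d(z,y)^2\le\frac12d(z,x_0)^2+\frac12d(z,x_1)^2-\frac14d(x_0,x_1)^2$ for all $z$. Mask: finitely supported nonnegative $(a_i)_{i\in\mathbb Z^s}$ with $\sum_ja_{i-2j}=1$ for all $i$. Barycentric scheme on $X$: $Sx_i=\operatorname{argmin}_{y\in X}\sum_ja_{i-2j}d^2(x_j,y)$. Convergence: for every bounded $x$ there is a continuous $S^\infty x:\mathbb R^s\to X$ with $\sup_jd(S^\infty x(j/2^n),(S^nx)_j)\to0$ as $n\to\infty$. *)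

(* Defs.v *)
From Stdlib Require Import Reals Lra ZArith List Classical ClassicalEpsilon.
From Stdlib Require Fin.
Open Scope R_scope.

Definition Zs (s : nat) := Fin.t s -> Z.
Definition Rs (s : nat) := Fin.t s -> R.

Definition adj {s : nat} (i j : Zs s) : Prop :=
  forall c : Fin.t s, (Z.abs (i c - j c) <= 1)%Z.

Definition is_metric {X : Type} (d : X -> X -> R) : Prop :=
  (forall x y, 0 <= d x y) /\
  (forall x y, d x y = 0 <-> x = y) /\
  (forall x y, d x y = d y x) /\
  (forall x y z, d x z <= d x y + d y z).

Definition is_complete {X : Type} (d : X -> X -> R) : Prop :=
  forall u : nat -> X,
    (forall eps, eps > 0 -> exists N : nat, forall m n : nat,
        (m >= N)%nat -> (n >= N)%nat -> d (u m) (u n) < eps) ->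
    exists l : X, forall eps, eps > 0 -> exists N : nat, forall n : nat,
        (n >= N)%nat -> d (u n) l < eps.

Definition is_hadamard {X : Type} (d : X -> X -> R) : Prop :=
  is_metric d /\ is_complete d /\
  forall x0 x1 : X, exists y : X, forall z : X,
    (d z y) ^ 2 <= / 2 * (d z x0) ^ 2 + / 2 * (d z x1) ^ 2 - / 4 * (d x0 x1) ^ 2.

Fixpoint lsum {A : Type} (l : list A) (f : A -> R) : R :=
  match l with nil => 0 | k :: l' => f k + lsum l' f end.

(** [msum a supp i F] is  sum_{j in Z^s} a_{i-2j} F(j), for a mask [a] whose
    support is contained in the duplicate-free list [supp]: the term with
    i - 2j = k is present iff i - k is componentwise even, and then j = (i-k)/2. *)
Definition msum {s : nat} (a : Zs s -> R) (supp : list (Zs s)) (i : Zs s)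
    (F : Zs s -> R) : R :=
  lsum supp (fun k =>
    if excluded_middle_informative (forall c, Z.Even (i c - k c))
    then a k * F (fun c => ((i c - k c) / 2)%Z) else 0).

Definition is_mask {s : nat} (a : Zs s -> R) (supp : list (Zs s)) : Prop :=
  NoDup supp /\
  (forall k, a k <> 0 -> In k supp) /\
  (forall k, 0 <= a k) /\
  (forall i, msum a supp i (fun _ => 1) = 1).

(** Barycentric scheme: (Sx)_i = argmin_y sum_j a_{i-2j} d^2(x_j, y)
    (a minimiser chosen by Hilbert's epsilon; in a Hadamard space it exists
    and is unique). *)
Definition subdiv {s : nat} (a : Zs s -> R) (supp : list (Zs s))
    {X : Type} (d : X -> X -> R) (x : Zs s -> X) : Zs s -> X :=
  fun i => epsilon (inhabits (x i)) (fun y =>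
    forall z : X, msum a supp i (fun j => (d (x j) y) ^ 2)
               <= msum a supp i (fun j => (d (x j) z) ^ 2)).

Definition iter_subdiv {s : nat} (a : Zs s -> R) (supp : list (Zs s))
    {X : Type} (d : X -> X -> R) (n : nat) (x : Zs s -> X) : Zs s -> X :=
  Nat.iter n (subdiv a supp d) x.

Definition bounded_seq {s : nat} {X : Type} (d : X -> X -> R) (x : Zs s -> X) : Prop :=
  exists M, forall i j : Zs s, d (x i) (x j) <= M.

Definition Dinf {s : nat} {X : Type} (d : X -> X -> R) (x : Zs s -> X) : R :=
  epsilon (inhabits 0) (fun m =>
    is_lub (fun r => exists i j : Zs s, adj i j /\ r = d (x i) (x j)) m).

Definition continuous_Rs {s : nat} {X : Type} (d : X -> X -> R) (f : Rs s -> X) : Prop :=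
  forall t : Rs s, forall eps, eps > 0 -> exists delta, delta > 0 /\
    forall u : Rs s, (forall c, Rabs (u c - t c) < delta) -> d (f u) (f t) < eps.

Definition scheme_convergent {s : nat} (a : Zs s -> R) (supp : list (Zs s))
    {X : Type} (d : X -> X -> R) : Prop :=
  forall x : Zs s -> X, bounded_seq d x ->
    exists Sinf : Rs s -> X, continuous_Rs d Sinf /\
      forall eps, eps > 0 -> exists N : nat, forall n : nat, (n >= N)%nat ->
        forall j : Zs s,
          d (Sinf (fun c => IZR (j c) / 2 ^ n)) (iter_subdiv a supp d n x j) <= eps.

(* Main.v *)
Require Import Defs.
From Stdlib Require Import Reals ZArith List.
From Stdlib Require Import Lra Lia Classical ClassicalEpsilon FunctionalExtensionality.
From Stdlib Require Fin.
Open Scope R_scope.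

(** A barycentre [b] of weighted points [x_k] satisfies
    [d(b, z) <= sum_k w_k d(x_k, z)] in every Hadamard space, so [d(Sx_i, Sx_i')] is at
    most the mean distance of [x_j] and [x_j'] when [j] and [j'] are drawn independently
    with probabilities [a_{i-2j}] and [a_{i'-2j'}].

    Contractivity gives convergence: the step functions [t |-> (S^n x)_{floor(2^n t)}]
    are uniformly Cauchy, since [(S^{n+1} x)_i] lies within a multiple of [D(S^n x)]
    of [(S^n x)_{floor(i/2)}].

    Conversely, convergence on the real line alone suffices.  Apply it to the indicators
    of the subsets of a finite box: since limit functions are continuous, for large [n]
    the [n]-step random walks [i -> j] started at nearby indices cannot have disjoint
    supports.  Hence two independent walks from indices at distance at most [2M]
    ([M] bounds the support of the mask, and this distance bound is preserved) meet after
    [n] steps with a probability bounded below, which contracts the largest distance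
    between values at such indices by a factor that does not depend on the space. *)

(** * Choice and finite sums *)

Lemma choice {A B : Type} (P : A -> B -> Prop) :
  (forall x, exists y, P x y) -> exists f : A -> B, forall x, P x (f x).
Proof.
  intros H.
  exists (fun x => proj1_sig (constructive_indefinite_description _ (H x))).
  intros x. exact (proj2_sig (constructive_indefinite_description _ (H x))).
Qed.

Lemma lsum_plus {A : Type} (l : list A) (f g : A -> R) :
  lsum l (fun k => f k + g k) = lsum l f + lsum l g.
Proof. induction l as [|k l IH]; simpl; [lra | rewrite IH; lra]. Qed.

Lemma lsum_scal {A : Type} (l : list A) (c : R) (f : A -> R) :
  lsum l (fun k => c * f k) = c * lsum l f.
Proof. induction l as [|k l IH]; simpl; [lra | rewrite IH; lra]. Qed.

Lemma lsum_ext {A : Type} (l : list A) (f g : A -> R) :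
  (forall k, f k = g k) -> lsum l f = lsum l g.
Proof. intros H; induction l as [|k l IH]; simpl; [lra | rewrite IH, H; lra]. Qed.

Lemma lsum_le {A : Type} (l : list A) (f g : A -> R) :
  (forall k, In k l -> f k <= g k) -> lsum l f <= lsum l g.
Proof.
  induction l as [|k l IH]; simpl; intros H; [lra|].
  assert (f k <= g k) by auto.
  assert (lsum l f <= lsum l g) by auto. lra.
Qed.

Lemma lsum_le_gap {A : Type} (l : list A) (f g : A -> R) (k0 : A) (e : R) :
  In k0 l -> (forall k, In k l -> f k <= g k) -> f k0 <= g k0 - e ->
  lsum l f <= lsum l g - e.
Proof.
  induction l as [|k l IH]; simpl; intros Hin H He; [tauto|].
  destruct Hin as [->|Hin].
  - assert (lsum l f <= lsum l g) by (apply lsum_le; auto). lra.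
  - assert (f k <= g k) by auto.
    assert (lsum l f <= lsum l g - e) by auto. lra.
Qed.

(** * Barycentres in Hadamard spaces *)

Definition weights {K : Type} (l : list K) (w : K -> R) : Prop :=
  (forall k, 0 <= w k) /\ lsum l w = 1.

Definition energy {K X : Type} (l : list K) (w : K -> R) (d : X -> X -> R)
    (p : K -> X) (y : X) : R :=
  lsum l (fun k => w k * (d (p k) y) ^ 2).

Lemma energy_nonneg {K X : Type} (l : list K) (w : K -> R) (d : X -> X -> R)
    (p : K -> X) (y : X) :
  weights l w -> 0 <= energy l w d p y.
Proof.
  intros [Hw _]. unfold energy.
  replace 0 with (lsum l (fun _ : K => 0)).
  - apply lsum_le; intros k _.
    apply Rmult_le_pos; [apply Hw | apply pow2_ge_0].
  - clear; induction l; simpl; lra.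
Qed.

(** Averaging the midpoint inequality over the weights transfers it to the energy. Testing it at
    [y0] gives [d y0 m <= / 2 * d y0 y1], and the triangle inequality turns this into the lower
    bound on [d m y1]. *)
Lemma energy_midpoint {K X : Type} (l : list K) (w : K -> R) (d : X -> X -> R)
    (p : K -> X) :
  weights l w -> is_hadamard d -> forall y0 y1, exists m,
    energy l w d p m <=
      / 2 * energy l w d p y0 + / 2 * energy l w d p y1 - / 4 * d y0 y1 ^ 2 /\
    / 2 * d y0 y1 <= d m y1.
Proof.
  intros [Hw Hw1] [[Hpos [Heq [_ Htri]]] [_ Hmid]] y0 y1.
  destruct (Hmid y0 y1) as [m Hm]. exists m; split.
  - unfold energy.
    replace (/ 2 * _ + / 2 * _ - / 4 * d y0 y1 ^ 2) with
      (lsum l (fun k => / 2 * (w k * d (p k) y0 ^ 2) + (/ 2 * (w k * d (p k) y1 ^ 2)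
         + (- (/ 4 * d y0 y1 ^ 2)) * w k))).
    + apply lsum_le; intros k _. specialize (Hw k). specialize (Hm (p k)). nra.
    + rewrite !lsum_plus, !lsum_scal, Hw1; lra.
  - assert (E := Hm y0).
    assert (Z0 : d y0 y0 = 0) by (apply Heq; reflexivity). rewrite Z0 in E.
    specialize (Htri y0 m y1).
    assert (d y0 m <= / 2 * d y0 y1).
    { apply Rsqr_incr_0_var; [unfold Rsqr; nra | specialize (Hpos y0 y1); lra]. }
    lra.
Qed.

(** A minimising sequence is Cauchy, since the midpoint of two nearly optimal but distant points
    would have energy below the infimum [m]; its limit attains [m]. *)
Lemma energy_min_exists {K X : Type} (l : list K) (w : K -> R) (d : X -> X -> R)
    (p : K -> X) (x0 : X) :
  weights l w -> is_hadamard d -> exists b, forall z, energy l w d p b <= energy l w d p z.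
Proof.
  intros HW Hd.
  destruct (completeness (fun r => exists y, r = - energy l w d p y)) as [m' [Hub Hlub]].
  { exists 0. intros r [y ->]. generalize (energy_nonneg l w d p y HW); lra. }
  { exists (- energy l w d p x0), x0; reflexivity. }
  set (m := - m').
  assert (Hm : forall z, m <= energy l w d p z).
  { intros z. assert (- energy l w d p z <= m') by (apply Hub; exists z; auto).
    unfold m; lra. }
  assert (Hap : forall n : nat, exists y, energy l w d p y < m + / INR (S n)).
  { intros n. apply NNPP; intros HN.
    assert (0 < / INR (S n)) by (apply Rinv_0_lt_compat, lt_0_INR; lia).
    assert (m' <= m' - / INR (S n)); [|lra].
    apply Hlub. intros r [y ->].
    destruct (Rle_or_lt (m + / INR (S n)) (energy l w d p y)) as [h|h];
      [unfold m in h; lra | exfalso; eauto]. }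
  destruct (choice _ Hap) as [u Hu].
  assert (Hsmall : forall eps, eps > 0 -> exists N, forall n, (n >= N)%nat -> / INR (S n) < eps).
  { intros eps He. destruct (archimed_cor1 eps He) as [N [HN HN0]].
    exists N; intros n Hn. apply Rle_lt_trans with (2 := HN).
    apply Rinv_le_contravar; [apply lt_0_INR; lia | apply le_INR; lia]. }
  destruct Hd as [HM [Hc Hmid]].
  assert (Hd : is_hadamard d) by (repeat split; try apply HM; auto).
  destruct HM as [Hpos [Heq [Hsym Htri]]].
  destruct (Hc u) as [b Hb].
  (* Both energies exceed [m] by less than [eps ^ 2 / 8], so the midpoint inequality forces
     [d (u i) (u j) ^ 2 < eps ^ 2 / 2]. *)
  { intros eps He. destruct (Hsmall (eps ^ 2 / 8)) as [N HN]; [nra|].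
    exists N; intros i j Hi Hj.
    destruct (energy_midpoint l w d p HW Hd (u i) (u j)) as [q [Hq _]].
    specialize (Hm q). generalize (Hu i), (Hu j), (HN i Hi), (HN j Hj), (Hpos (u i) (u j)).
    intros. nra. }
  exists b. intros z. apply Rle_trans with (2 := Hm z).
  (* [d^2 <= (1+eta) d'^2 + (1+1/eta) e^2] replaces the continuity of the energy. *)
  apply le_epsilon; intros g Hg.
  assert (Hm0 : 0 <= m).
  { unfold m. assert (m' <= 0); [|lra]. apply Hlub.
    intros r [y ->]. generalize (energy_nonneg l w d p y HW); lra. }
  (* Error budget: [eta * (m + 1) <= g / 4], [(1 + / eta) * e ^ 2 = g / 4], and the energy at [u n]
     is below [m + g / 8], so the total stays below [m + g]. The [m + 1] avoids division by zero. *)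
  set (eta := Rmin 1 (g / (4 * (m + 1)))).
  assert (He0 : 0 < eta).
  { unfold eta. apply Rmin_glb_lt; [lra|]. apply Rdiv_lt_0_compat; lra. }
  assert (He1 : eta <= 1) by apply Rmin_l.
  assert (He2 : eta * (m + 1) <= g / 4).
  { apply Rle_trans with (g / (4 * (m + 1)) * (m + 1)).
    - apply Rmult_le_compat_r; [lra | apply Rmin_r].
    - right; field; lra. }
  destruct (Hsmall (g / 8)) as [N1 HN1]; [lra|].
  set (e := sqrt (g / 4 / (1 + / eta))).
  assert (0 < / eta) by (apply Rinv_0_lt_compat; auto).
  assert (0 < g / 4 / (1 + / eta)) by (apply Rdiv_lt_0_compat; lra).
  assert (He : e > 0) by (apply sqrt_lt_R0; auto).
  assert (Hee : e * e = g / 4 / (1 + / eta)) by (apply sqrt_sqrt; lra).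
  destruct (Hb e He) as [N2 HN2].
  set (n := (N1 + N2)%nat).
  assert (Hn1 := HN1 n ltac:(lia)). assert (Hn2 := HN2 n ltac:(lia)).
  specialize (Hu n).
  assert (Hk : energy l w d p b <=
     (1 + eta) * energy l w d p (u n) + (1 + / eta) * e ^ 2).
  { destruct HW as [Hw Hw1]. unfold energy.
    replace ((1 + / eta) * e ^ 2) with ((1 + / eta) * e ^ 2 * lsum l w)
      by (rewrite Hw1; ring).
    rewrite <- !lsum_scal, <- lsum_plus.
    apply lsum_le; intros k _. specialize (Hw k).
    replace ((1 + eta) * (w k * d (p k) (u n) ^ 2) + (1 + / eta) * e ^ 2 * w k) with
      (w k * ((1 + eta) * d (p k) (u n) ^ 2 + (1 + / eta) * e ^ 2)) by ring.
    apply Rmult_le_compat_l; auto.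
    assert (H3 := Htri (p k) (u n) b).
    assert (d (p k) b ^ 2 <= (d (p k) (u n) + e) ^ 2).
    { apply pow_incr. split; [auto|lra]. }
    assert (0 <= / eta * (eta * d (p k) (u n) - e) ^ 2).
    { apply Rmult_le_pos; [lra | apply pow2_ge_0]. }
    replace (/ eta * (eta * d (p k) (u n) - e) ^ 2) with
      (eta * d (p k) (u n) ^ 2 - 2 * d (p k) (u n) * e + / eta * e ^ 2) in * by (field; lra).
    lra. }
  replace ((1 + / eta) * e ^ 2) with (g / 4) in Hk
    by (replace (e ^ 2) with (e * e) by ring; rewrite Hee; field; lra).
  nra.
Qed.

(** Strong convexity of the energy turns minimality into quadratic growth away from [b]; the
    quadratic term drives the Jensen inequality below. *)
Lemma variance_inequality {K X : Type} (l : list K) (w : K -> R) (d : X -> X -> R)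
    (p : K -> X) (b : X) :
  weights l w -> is_hadamard d ->
  (forall z, energy l w d p b <= energy l w d p z) ->
  forall z, energy l w d p b + d z b ^ 2 <= energy l w d p z.
Proof.
  intros HW Hd Hb.
  assert (Hpos : forall x y, 0 <= d x y) by apply Hd.
  (* Testing with the midpoint of [z] and [b] improves a constant [c] to [(1 + c) / 2]. *)
  assert (Hc : forall n z, energy l w d p b + (1 - (/ 2) ^ n) * d z b ^ 2 <= energy l w d p z).
  { induction n as [|n IH]; intros z; simpl; [specialize (Hb z); lra|].
    destruct (energy_midpoint l w d p HW Hd z b) as [m [Hm1 Hm2]].
    specialize (IH m).
    assert (H0 : (/ 2) ^ n <= 1) by (rewrite <- (pow1 n); apply pow_incr; lra).
    assert ((/ 2 * d z b) ^ 2 <= d m b ^ 2).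
    { apply pow_incr. split; auto. specialize (Hpos z b); lra. }
    nra. }
  (* Let [n] tend to infinity: a failure at [z] leaves a positive gap, which [(/ 2) ^ N * D]
     undercuts for large [N]. Dividing by [D + 1] covers [D = 0]. *)
  intros z. apply Rnot_lt_le; intros Hlt.
  set (D := d z b ^ 2) in *.
  assert (HD : 0 <= D) by apply pow2_ge_0.
  assert (Hg : 0 < (energy l w d p b + D - energy l w d p z) / (D + 1))
    by (apply Rdiv_lt_0_compat; lra).
  destruct (pow_lt_1_zero (/ 2) ltac:(rewrite Rabs_right; lra) _ Hg) as [N HN].
  specialize (HN N ltac:(lia)). specialize (Hc N z). fold D in Hc.
  assert (0 < (/ 2) ^ N) by (apply pow_lt; lra).
  rewrite Rabs_right in HN by lra.
  apply (Rmult_lt_compat_r (D + 1)) in HN; [|lra].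
  unfold Rdiv in HN. rewrite Rmult_assoc, Rinv_l in HN by lra. nra.
Qed.

(* With [u = d(x,z)], [v = d(x,b)], [D = d(b,z)], the triangle inequality gives
   [2 D u >= D^2 + u^2 - v^2]; average it and use the variance inequality. *)
Lemma jensen_distance {K X : Type} (l : list K) (w : K -> R) (d : X -> X -> R)
    (p : K -> X) (b : X) :
  weights l w -> is_hadamard d ->
  (forall z, energy l w d p b <= energy l w d p z) ->
  forall z, d b z <= lsum l (fun k => w k * d (p k) z).
Proof.
  intros HW Hd Hb z.
  assert (Hv := variance_inequality l w d p b HW Hd Hb z).
  destruct HW as [Hw Hw1]. destruct Hd as [[Hpos [_ [Hsym Htri]]] _].
  rewrite (Hsym z b) in Hv.
  set (D := d b z) in *.
  assert (HD : 0 <= D) by apply Hpos.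
  assert (H : D ^ 2 + (energy l w d p z + - 1 * energy l w d p b) <=
     2 * D * lsum l (fun k => w k * d (p k) z)).
  { replace (D ^ 2) with (D ^ 2 * lsum l w) by (rewrite Hw1; ring). unfold energy.
    rewrite <- !lsum_scal, <- !lsum_plus.
    apply lsum_le; intros k _. specialize (Hw k).
    assert (0 <= d (p k) b ^ 2 - (D - d (p k) z) ^ 2).
    { assert (H1 := Htri b (p k) z). assert (H2 := Htri (p k) b z).
      assert (H3 := Htri (p k) z b). rewrite (Hsym b (p k)) in H1.
      rewrite (Hsym z b) in H3. fold D in H1, H2, H3.
      replace (d (p k) b ^ 2 - (D - d (p k) z) ^ 2) with
        ((d (p k) b - D + d (p k) z) * (d (p k) b + D - d (p k) z)) by ring.
      apply Rmult_le_pos; lra. }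
    nra. }
  assert (H0 : 0 <= lsum l (fun k => w k * d (p k) z)).
  { replace 0 with (lsum l (fun k => 0 * w k)) by (rewrite lsum_scal; lra).
    apply lsum_le; intros k _. rewrite Rmult_0_l.
    apply Rmult_le_pos; auto. }
  nra.
Qed.

(** * One subdivision step as an average over parents *)

(** Indexing by the mask position [k] instead of [j = (i - k) / 2] lets every [i] share the list
    [supp]; positions of the wrong parity get weight zero. *)
Definition cell_weight {s : nat} (a : Zs s -> R) (i k : Zs s) : R :=
  if excluded_middle_informative (forall c, Z.Even (i c - k c)) then a k else 0.

Definition half_diff {s : nat} (i k : Zs s) : Zs s := fun c => ((i c - k c) / 2)%Z.

Lemma msum_lsum {s : nat} (a : Zs s -> R) (supp : list (Zs s)) (i : Zs s) (F : Zs s -> R) :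
  msum a supp i F = lsum supp (fun k => cell_weight a i k * F (half_diff i k)).
Proof.
  apply lsum_ext; intros k. unfold cell_weight, half_diff.
  destruct excluded_middle_informative; ring.
Qed.

Lemma cell_weights {s : nat} (a : Zs s -> R) (supp : list (Zs s)) (i : Zs s) :
  is_mask a supp -> weights supp (cell_weight a i).
Proof.
  intros [_ [_ [Ha H1]]]. split.
  - intros k. unfold cell_weight. destruct excluded_middle_informative; auto; lra.
  - rewrite <- (H1 i), msum_lsum. apply lsum_ext; intros; ring.
Qed.

Definition mask_arg {s : nat} (i j : Zs s) : Zs s := fun c => (i c - 2 * j c)%Z.

(** A possible step of the backward random walk, from [i] to an index [j] of the preceding, coarser
    level. *)
Definition parent {s : nat} (a : Zs s -> R) (i j : Zs s) : Prop := 0 < a (mask_arg i j).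

Lemma cell_weight_mask_arg {s : nat} (a : Zs s -> R) (i j : Zs s) :
  cell_weight a i (mask_arg i j) = a (mask_arg i j) /\ half_diff i (mask_arg i j) = j.
Proof.
  unfold cell_weight, half_diff, mask_arg. split.
  - destruct excluded_middle_informative as [_|n]; auto.
    exfalso; apply n; intros c; exists (j c); lia.
  - extensionality c. replace (i c - (i c - 2 * j c))%Z with (j c * 2)%Z by lia.
    apply Z.div_mul; lia.
Qed.

Lemma cell_weight_pos_parent {s : nat} (a : Zs s -> R) (i k : Zs s) :
  0 < cell_weight a i k -> parent a i (half_diff i k).
Proof.
  unfold cell_weight, parent. destruct excluded_middle_informative as [e|_]; [|lra].
  replace (mask_arg i (half_diff i k)) with k; auto.
  extensionality c. unfold mask_arg, half_diff. destruct (e c) as [q Hq].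
  rewrite Hq, (Z.mul_comm 2 q), Z.div_mul; lia.
Qed.

(** The epsilon term is a genuine minimiser because one exists, so Jensen's inequality applies to
    it. *)
Lemma subdiv_jensen {s : nat} (a : Zs s -> R) (supp : list (Zs s)) {X : Type}
    (d : X -> X -> R) (x : Zs s -> X) (i : Zs s) (z : X) :
  is_mask a supp -> is_hadamard d ->
  d (subdiv a supp d x i) z <=
    lsum supp (fun k => cell_weight a i k * d (x (half_diff i k)) z).
Proof.
  intros Hm Hd. assert (HW := cell_weights a supp i Hm).
  apply (jensen_distance supp (cell_weight a i) d (fun k => x (half_diff i k)));
    auto. unfold energy.
  assert (Hex : exists y, forall z : X, msum a supp i (fun j => (d (x j) y) ^ 2)
               <= msum a supp i (fun j => (d (x j) z) ^ 2)).
  { destruct (energy_min_exists supp (cell_weight a i) d (fun k => x (half_diff i k))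
      (x i) HW Hd) as [b Hb].
    exists b; intros z'. rewrite !msum_lsum. apply Hb. }
  intros z'. assert (H := epsilon_spec (inhabits (x i)) _ Hex z').
  cbv beta in H. rewrite !msum_lsum in H. exact H.
Qed.

(** A single parent that is closer by [e] lowers the average by its weight times [e]; this is the
    source of all contraction. *)
Lemma subdiv_dist_le_gap {s : nat} (a : Zs s -> R) (supp : list (Zs s)) {X : Type}
    (d : X -> X -> R) (x : Zs s -> X) (i j0 : Zs s) (z : X) (B e : R) :
  is_mask a supp -> is_hadamard d ->
  (forall j, parent a i j -> d (x j) z <= B) ->
  parent a i j0 -> d (x j0) z <= B - e ->
  d (subdiv a supp d x i) z <= B - a (mask_arg i j0) * e.
Proof.
  intros Hm Hd HB Hj0 He.
  apply Rle_trans with (1 := subdiv_jensen a supp d x i z Hm Hd).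
  destruct (cell_weights a supp i Hm) as [Hw Hw1].
  destruct (cell_weight_mask_arg a i j0) as [E1 E2].
  replace (B - a (mask_arg i j0) * e) with
    (lsum supp (fun k => B * cell_weight a i k) - a (mask_arg i j0) * e)
    by (rewrite lsum_scal, Hw1; ring).
  apply lsum_le_gap with (k0 := mask_arg i j0).
  - apply Hm. unfold parent in Hj0; lra.
  (* Positions that do not give a parent carry weight zero, so a bound on parents suffices. *)
  - intros k _. rewrite Rmult_comm.
    destruct (Rle_lt_or_eq_dec _ _ (Hw k)) as [h|<-]; [|lra].
    apply Rmult_le_compat_r; auto. apply HB, cell_weight_pos_parent; auto.
  - rewrite E1, E2. unfold parent in Hj0. nra.
Qed.

Lemma subdiv_dist_le {s : nat} (a : Zs s -> R) (supp : list (Zs s)) {X : Type}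
    (d : X -> X -> R) (x : Zs s -> X) (i : Zs s) (z : X) (B : R) :
  is_mask a supp -> is_hadamard d ->
  (forall j, parent a i j -> d (x j) z <= B) ->
  d (subdiv a supp d x i) z <= B.
Proof.
  intros Hm Hd HB.
  apply Rle_trans with (1 := subdiv_jensen a supp d x i z Hm Hd).
  destruct (cell_weights a supp i Hm) as [Hw Hw1].
  replace B with (lsum supp (fun k => B * cell_weight a i k))
    by (rewrite lsum_scal, Hw1; ring).
  apply lsum_le. intros k _. rewrite Rmult_comm.
  destruct (Rle_lt_or_eq_dec _ _ (Hw k)) as [h|<-]; [|lra].
  apply Rmult_le_compat_r; auto. apply HB, cell_weight_pos_parent; auto.
Qed.

Lemma subdiv_dist2_le {s : nat} (a : Zs s -> R) (supp : list (Zs s)) {X : Type}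
    (d : X -> X -> R) (x : Zs s -> X) (i i' : Zs s) (B : R) :
  is_mask a supp -> is_hadamard d ->
  (forall j j', parent a i j -> parent a i' j' -> d (x j) (x j') <= B) ->
  d (subdiv a supp d x i) (subdiv a supp d x i') <= B.
Proof.
  intros Hm Hd HB. assert (Hsym : forall y z, d y z = d z y) by apply Hd.
  apply subdiv_dist_le; auto. intros j Hj. rewrite Hsym.
  apply subdiv_dist_le; auto. intros j' Hj'. rewrite Hsym. auto.
Qed.

(** The support of the [n]-step backward walk. Its first step matches the outermost [subdiv] of
    [iter_subdiv]. *)
Fixpoint ancestor {s : nat} (a : Zs s -> R) (n : nat) (i j : Zs s) : Prop :=
  match n with
  | O => i = j
  | S n' => exists i1, parent a i i1 /\ ancestor a n' i1 j
  end.

(** Locality: only the data at the ancestors of [i] influence the value at [i]. Applied to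
    indicators, it yields the exact values 0 and 1. *)
Lemma iter_subdiv_const {s : nat} (a : Zs s -> R) (supp : list (Zs s)) {X : Type}
    (d : X -> X -> R) (x : Zs s -> X) (p : X) :
  is_mask a supp -> is_hadamard d ->
  forall n i, (forall j, ancestor a n i j -> x j = p) -> iter_subdiv a supp d n x i = p.
Proof.
  intros Hm Hd. assert (Hd' := Hd). destruct Hd' as [[Hpos [Heq _]] _].
  induction n as [|n IH]; intros i H; simpl.
  - apply H; reflexivity.
  - apply Heq, Rle_antisym; auto. apply subdiv_dist_le; auto.
    intros j Hj. right. apply Heq. apply IH. intros j' Hj'.
    apply H. exists j; auto.
Qed.

Lemma bounded_subdiv {s : nat} (a : Zs s -> R) (supp : list (Zs s)) {X : Type}
    (d : X -> X -> R) (x : Zs s -> X) :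
  is_mask a supp -> is_hadamard d -> bounded_seq d x -> bounded_seq d (subdiv a supp d x).
Proof.
  intros Hm Hd [M HM]. exists M. intros i j. apply subdiv_dist2_le; auto.
Qed.

Lemma bounded_iter_subdiv {s : nat} (a : Zs s -> R) (supp : list (Zs s)) {X : Type}
    (d : X -> X -> R) (x : Zs s -> X) (n : nat) :
  is_mask a supp -> is_hadamard d -> bounded_seq d x ->
  bounded_seq d (iter_subdiv a supp d n x).
Proof. intros; induction n; simpl; auto using bounded_subdiv. Qed.

(** * Bounds for the mask and for data at nearby indices *)

Definition close {s : nat} (r : Z) (i j : Zs s) : Prop :=
  forall c, (Z.abs (i c - j c) <= r)%Z.

Lemma mask_bound_exists {s : nat} (a : Zs s -> R) (supp : list (Zs s)) :
  is_mask a supp -> exists M, (1 <= M)%Z /\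
    forall i j, parent a i j -> forall c, (Z.abs (i c - 2 * j c) <= M)%Z.
Proof.
  intros [_ [Hs _]].
  assert (Hvec : forall n (k : Fin.t n -> Z), exists M, forall c, (Z.abs (k c) <= M)%Z).
  { induction n as [|n IH]; intros k.
    - exists 0%Z. intros c. inversion c.
    - destruct (IH (fun c => k (Fin.FS c))) as [M HM].
      exists (Z.max M (Z.abs (k Fin.F1))). intros c.
      pattern c; apply (Fin.caseS' c); clear c; [lia | intros c; specialize (HM c); lia]. }
  assert (HL : exists M, (1 <= M)%Z /\ forall k, In k supp -> forall c, (Z.abs (k c) <= M)%Z).
  { clear Hs. induction supp as [|k l [M [H1 HM]]].
    - exists 1%Z; split; [lia | intros k []].
    - destruct (Hvec s k) as [M' HM']. exists (Z.max M M'); split; [lia|].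
      intros k' [->|Hk] c; [specialize (HM' c); lia | specialize (HM k' Hk c); lia]. }
  destruct HL as [M [H1 HM]]. exists M; split; auto.
  intros i j Hp c. apply (HM (mask_arg i j)). apply Hs. unfold parent in Hp. lra.
Qed.

Lemma mask_min_exists {s : nat} (a : Zs s -> R) (supp : list (Zs s)) :
  is_mask a supp -> exists alpha, 0 < alpha <= 1 /\
    forall i j, parent a i j -> alpha <= a (mask_arg i j).
Proof.
  intros [_ [Hs _]].
  assert (HL : exists al, 0 < al <= 1 /\ forall k, In k supp -> 0 < a k -> al <= a k).
  { clear Hs. induction supp as [|k l [al [H1 HM]]].
    - exists 1; split; [lra | intros k []].
    - destruct (Rlt_or_le 0 (a k)) as [h|h].
      + exists (Rmin al (a k)). split.
        * split; [apply Rmin_glb_lt; lra | apply Rle_trans with al; [apply Rmin_l | lra]].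
        * intros k' [->|Hk] Hk0; [apply Rmin_r |].
          apply Rle_trans with al; [apply Rmin_l | auto].
      + exists al; split; auto. intros k' [->|Hk] Hk0; [lra | auto]. }
  destruct HL as [al [H1 H2]]. exists al; split; auto.
  intros i j Hp. apply H2; auto. apply Hs. unfold parent in Hp; lra.
Qed.

Lemma is_lub_Dinf {s : nat} {X : Type} (d : X -> X -> R) (x : Zs s -> X) :
  bounded_seq d x ->
  is_lub (fun r => exists i j : Zs s, adj i j /\ r = d (x i) (x j)) (Dinf d x).
Proof.
  intros [M HM]. unfold Dinf. apply epsilon_spec.
  destruct (completeness (fun r => exists i j : Zs s, adj i j /\ r = d (x i) (x j)))
    as [m Hm].
  - exists M. intros r [i [j [_ ->]]]. apply HM.
  - exists (d (x (fun _ => 0%Z)) (x (fun _ => 0%Z))). exists (fun _ => 0%Z), (fun _ => 0%Z).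
    split; auto. intros c; lia.
  - exists m; exact Hm.
Qed.

Lemma dist_le_Dinf {s : nat} {X : Type} (d : X -> X -> R) (x : Zs s -> X) (i j : Zs s) :
  bounded_seq d x -> adj i j -> d (x i) (x j) <= Dinf d x.
Proof. intros Hb Ha. apply (is_lub_Dinf d x Hb). exists i, j; auto. Qed.

Lemma Dinf_le {s : nat} {X : Type} (d : X -> X -> R) (x : Zs s -> X) (B : R) :
  bounded_seq d x -> (forall i j, adj i j -> d (x i) (x j) <= B) -> Dinf d x <= B.
Proof. intros Hb HB. apply (is_lub_Dinf d x Hb). intros r [i [j [Ha ->]]]; auto. Qed.

Lemma Dinf_nonneg {s : nat} {X : Type} (d : X -> X -> R) (x : Zs s -> X) :
  is_metric d -> bounded_seq d x -> 0 <= Dinf d x.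
Proof.
  intros [Hpos _] Hb.
  apply Rle_trans with (1 := Hpos (x (fun _ => 0%Z)) (x (fun _ => 0%Z))).
  apply dist_le_Dinf; auto. intros c; lia.
Qed.

Lemma dist_close_le {s : nat} {X : Type} (d : X -> X -> R) (x : Zs s -> X) :
  is_metric d -> bounded_seq d x -> forall (n : nat) (i j : Zs s),
  close (Z.of_nat n) i j -> d (x i) (x j) <= INR n * Dinf d x.
Proof.
  intros Hd Hb. destruct Hd as [Hpos [Heq [_ Htri]]].
  induction n as [|n IH]; intros i j Hc.
  - assert (i = j) as -> by (extensionality c; specialize (Hc c); lia).
    simpl. rewrite Rmult_0_l. right; apply Heq; reflexivity.
  (* Every coordinate moves one unit towards its target or stays there, so [i'] is adjacent to [i]
     and one step nearer to [j]. *)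
  - set (i' := fun c => (i c + Z.sgn (j c - i c))%Z).
    apply Rle_trans with (1 := Htri _ (x i') _).
    assert (d (x i) (x i') <= Dinf d x).
    { apply dist_le_Dinf; auto. intros c. unfold i'. lia. }
    assert (d (x i') (x j) <= INR n * Dinf d x).
    { apply IH. intros c. specialize (Hc c). unfold i'. lia. }
    rewrite S_INR. lra.
Qed.

(** The radius [2 * M] reproduces itself: [2 * |j - j'| <= 2 * M + M + M] in each coordinate. *)
Lemma parent_close {s : nat} (a : Zs s -> R) (M : Z) (i i' j j' : Zs s) :
  (forall i j, parent a i j -> forall c, (Z.abs (i c - 2 * j c) <= M)%Z) ->
  close (2 * M) i i' -> parent a i j -> parent a i' j' -> close (2 * M) j j'.
Proof.
  intros HM Hc Hj Hj' c. generalize (HM _ _ Hj c), (HM _ _ Hj' c), (Hc c). lia.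
Qed.

(** * From geometric decay to a continuous limit *)

Definition dyadic_floor {s : nat} (n : nat) (t : Rs s) : Zs s :=
  fun c => Int_part (t c * 2 ^ n).

Lemma IZR_lt_inv_succ (m n : Z) : IZR m < IZR n + 1 -> (m <= n)%Z.
Proof. intros H. apply Z.lt_succ_r, lt_IZR. rewrite succ_IZR. exact H. Qed.

Lemma dyadic_floor_IZR {s : nat} (n : nat) (j : Zs s) :
  dyadic_floor n (fun c => IZR (j c) / 2 ^ n) = j.
Proof.
  extensionality c. unfold dyadic_floor.
  assert (0 < 2 ^ n) by (apply pow_lt; lra).
  replace (IZR (j c) / 2 ^ n * 2 ^ n) with (IZR (j c)) by (field; lra).
  destruct (base_Int_part (IZR (j c))) as [H1 H2].
  apply Z.le_antisymm; apply IZR_lt_inv_succ; lra.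
Qed.

Lemma dyadic_floor_adj {s : nat} (n : nat) (t u : Rs s) :
  (forall c, Rabs (u c - t c) < / 2 ^ n) -> adj (dyadic_floor n u) (dyadic_floor n t).
Proof.
  intros H c. specialize (H c). unfold dyadic_floor.
  assert (Hp : 0 < 2 ^ n) by (apply pow_lt; lra).
  apply Rabs_def2 in H. destruct H as [Ha Hb].
  apply (Rmult_lt_compat_r (2 ^ n)) in Ha, Hb; auto.
  rewrite Ropp_mult_distr_l_reverse in Hb. rewrite Rinv_l in Ha, Hb by lra.
  destruct (base_Int_part (u c * 2 ^ n)) as [H1 H2].
  destruct (base_Int_part (t c * 2 ^ n)) as [H3 H4].
  assert (Int_part (u c * 2 ^ n) <= Int_part (t c * 2 ^ n) + 1)%Z
    by (apply IZR_lt_inv_succ; rewrite plus_IZR; lra).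
  assert (Int_part (t c * 2 ^ n) <= Int_part (u c * 2 ^ n) + 1)%Z
    by (apply IZR_lt_inv_succ; rewrite plus_IZR; lra).
  lia.
Qed.

(** Since the floor of [2 * y] is twice the floor of [y] plus 0 or 1, a parent of the fine cell of
    [t] stays near the coarse cell of [t]. *)
Lemma parent_dyadic_floor_close {s : nat} (a : Zs s -> R) (M : Z) (n : nat) (t : Rs s)
    (j : Zs s) :
  (forall i j, parent a i j -> forall c, (Z.abs (i c - 2 * j c) <= M)%Z) ->
  parent a (dyadic_floor (S n) t) j -> close (M + 1) j (dyadic_floor n t).
Proof.
  intros HM Hj c. specialize (HM _ _ Hj c). unfold dyadic_floor in *.
  replace (t c * 2 ^ S n) with (2 * (t c * 2 ^ n)) in HM by (simpl; ring).
  set (y := t c * 2 ^ n) in *.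
  destruct (base_Int_part y) as [H1 H2].
  destruct (base_Int_part (2 * y)) as [H3 H4].
  assert (Int_part (2 * y) <= 2 * Int_part y + 1)%Z
    by (apply IZR_lt_inv_succ; rewrite plus_IZR, mult_IZR; lra).
  assert (2 * Int_part y <= Int_part (2 * y))%Z
    by (apply IZR_lt_inv_succ; rewrite mult_IZR; lra).
  lia.
Qed.

Lemma geometric_small (q Q eps : R) :
  0 <= q < 1 -> 0 <= Q -> eps > 0 ->
  exists N, forall n, (n >= N)%nat -> Q * q ^ n < eps.
Proof.
  intros Hq HQ He.
  destruct (pow_lt_1_zero q ltac:(rewrite Rabs_right; lra) (eps / (Q + 1))) as [N HN].
  { apply Rdiv_lt_0_compat; lra. }
  exists N. intros n Hn. specialize (HN n Hn).
  assert (0 <= q ^ n) by (apply pow_le; lra).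
  rewrite Rabs_right in HN by lra.
  apply (Rmult_lt_compat_l (Q + 1)) in HN; [|lra].
  replace ((Q + 1) * (eps / (Q + 1))) with eps in HN by (field; lra). lra.
Qed.

Lemma geometric_decay_limit {s : nat} (a : Zs s -> R) (supp : list (Zs s)) {X : Type}
    (d : X -> X -> R) (x : Zs s -> X) (C gamma : R) :
  is_mask a supp -> is_hadamard d -> bounded_seq d x -> 0 <= C -> 0 < gamma < 1 ->
  (forall n, Dinf d (iter_subdiv a supp d n x) <= C * gamma ^ n) ->
  exists Sinf : Rs s -> X, continuous_Rs d Sinf /\
    forall eps, eps > 0 -> exists N : nat, forall n : nat, (n >= N)%nat ->
      forall j : Zs s,
        d (Sinf (fun c => IZR (j c) / 2 ^ n)) (iter_subdiv a supp d n x j) <= eps.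
Proof.
  intros Hm Hd Hb HC Hg HD.
  destruct (mask_bound_exists a supp Hm) as [M [HM1 HM]].
  assert (Hd' := Hd). destruct Hd' as [HMet [Hcomp _]].
  assert (HMet' := HMet). destruct HMet' as [Hpos [Heq [Hsym Htri]]].
  set (f := fun n (t : Rs s) => iter_subdiv a supp d n x (dyadic_floor n t)).
  set (K1 := INR (Z.to_nat (M + 1)) * C).
  assert (HK1 : 0 <= K1) by (apply Rmult_le_pos; auto; apply pos_INR).
  assert (Hstep : forall n t, d (f (S n) t) (f n t) <= K1 * gamma ^ n).
  { intros n t. unfold f at 1. simpl. apply subdiv_dist_le; auto.
    intros j Hj.
    apply Rle_trans with
      (INR (Z.to_nat (M + 1)) * Dinf d (iter_subdiv a supp d n x)).
    - apply (dist_close_le d (iter_subdiv a supp d n x)); auto using bounded_iter_subdiv.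
      rewrite Z2Nat.id by lia. apply parent_dyadic_floor_close with a; auto.
    - unfold K1. rewrite Rmult_assoc. apply Rmult_le_compat_l; auto. apply pos_INR. }
  set (Q := K1 / (1 - gamma)).
  assert (HQ : 0 <= Q).
  { unfold Q, Rdiv. apply Rmult_le_pos; auto. left. apply Rinv_0_lt_compat. lra. }
  assert (HQ1 : Q * (1 - gamma) = K1) by (unfold Q; field; lra).
  assert (Hgp : forall n, 0 <= gamma ^ n) by (intros; apply pow_le; lra).
  assert (Htail : forall n p t, d (f (n + p)%nat t) (f n t) <= Q * gamma ^ n).
  { intros n p t.
    (* The induction carries the exact partial sum of the geometric series with ratio [gamma] and
       factor [K1]. *)
    assert (d (f (n + p)%nat t) (f n t) <= Q * (gamma ^ n - gamma ^ (n + p))).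
    { induction p as [|p IH].
      - rewrite Nat.add_0_r. replace (d (f n t) (f n t)) with 0; [lra|].
        symmetry; apply Heq; reflexivity.
      - rewrite Nat.add_succ_r.
        apply Rle_trans with (1 := Htri _ (f (n + p)%nat t) _).
        specialize (Hstep (n + p)%nat t). simpl. nra. }
    specialize (Hgp (n + p)%nat). nra. }
  assert (Hlim : forall t, exists l, forall n, d (f n t) l <= Q * gamma ^ n).
  { intros t. destruct (Hcomp (fun n => f n t)) as [l Hl].
    - intros eps He.
      destruct (geometric_small gamma Q (eps / 2)) as [N HN]; [lra|auto|lra|].
      exists N. intros m n Hmn Hn.
      assert (H1 := Htail N (m - N)%nat t). assert (H2 := Htail N (n - N)%nat t).
      replace (N + (m - N))%nat with m in H1 by lia.
      replace (N + (n - N))%nat with n in H2 by lia.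
      apply Rle_lt_trans with (1 := Htri _ (f N t) _).
      rewrite (Hsym (f N t)). specialize (HN N ltac:(lia)). lra.
    - exists l. intros n. apply le_epsilon. intros eps He.
      destruct (Hl eps He) as [N HN].
      specialize (HN (n + N)%nat ltac:(lia)). cbv beta in HN.
      apply Rle_trans with (1 := Htri _ (f (n + N)%nat t) _).
      rewrite (Hsym (f n t)). specialize (Htail n N t). lra. }
  destruct (choice _ Hlim) as [L HL].
  exists L. split.
  - intros t eps He.
    (* Two tails [Q * gamma ^ N] lead from the limit to level [N], and [C * gamma ^ N] bounds the
       jump between adjacent cells there. *)
    destruct (geometric_small gamma (2 * Q + C) eps) as [N HN]; [lra|lra|auto|].
    specialize (HN N ltac:(lia)).
    exists (/ 2 ^ N). split; [apply Rinv_0_lt_compat, pow_lt; lra|].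
    intros u Hu. apply dyadic_floor_adj in Hu.
    assert (H1 : d (f N u) (f N t) <= C * gamma ^ N).
    { apply Rle_trans with (2 := HD N).
      apply (dist_le_Dinf d (iter_subdiv a supp d N x)); auto using bounded_iter_subdiv. }
    assert (H2 := HL u N). assert (H3 := HL t N). rewrite Hsym in H2.
    assert (H4 := Htri (L u) (f N u) (L t)).
    assert (H5 := Htri (f N u) (f N t) (L t)). lra.
  - intros eps He.
    destruct (geometric_small gamma Q eps) as [N HN]; [lra|auto|auto|].
    exists N. intros n Hn j. specialize (HN n Hn).
    assert (H := HL (fun c => IZR (j c) / 2 ^ n) n).
    unfold f in H. rewrite dyadic_floor_IZR, Hsym in H. lra.
Qed.

Lemma geometric_contraction_convergent {s : nat} (a : Zs s -> R) (supp : list (Zs s))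
    (C gamma : R) {X : Type} (d : X -> X -> R) :
  is_mask a supp -> is_hadamard d -> 0 <= C -> gamma < 1 ->
  (forall x : Zs s -> X, bounded_seq d x -> forall n : nat,
     Dinf d (iter_subdiv a supp d n x) <= C * gamma ^ n * Dinf d x) ->
  scheme_convergent a supp d.
Proof.
  intros Hm Hd HC Hg H x Hb.
  assert (HD := Dinf_nonneg d x (proj1 Hd) Hb).
  destruct (Rlt_or_le 0 gamma) as [Hg0|Hg0].
  - apply (geometric_decay_limit a supp d x (C * Dinf d x) gamma); auto; [nra|].
    intros n. specialize (H x Hb n). nra.
  (* For [gamma <= 0], the hypothesis with one step, applied to each iterate, makes [Dinf] at most 0
     from level 1 on, so the rate [/ 2] works. *)
  - apply (geometric_decay_limit a supp d x (Dinf d x) (/ 2)); auto; [lra|].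
    intros [|n]; [simpl; lra|].
    assert (Hbn := bounded_iter_subdiv a supp d x n Hm Hd Hb).
    assert (H1 := H _ Hbn 1%nat). simpl in H1 |- *.
    assert (HDn := Dinf_nonneg d _ (proj1 Hd) Hbn).
    assert (0 <= / 2 * (/ 2) ^ n) by (apply Rmult_le_pos; [lra | apply pow_le; lra]).
    assert (0 <= C * - gamma * Dinf d (iter_subdiv a supp d n x))
      by (repeat apply Rmult_le_pos; lra).
    nra.
Qed.

(** * Common ancestors from convergence on the real line *)

Lemma hadamard_R : is_hadamard Rdist.
Proof.
  split; [|split].
  - split; [|split; [|split]]; intros.
    + apply Rge_le, Rdist_pos.
    + apply Rdist_refl.
    + apply Rdist_sym.
    + apply Rdist_tri.
  - intros u Hu. destruct (R_complete u) as [l Hl].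
    + intros eps He. destruct (Hu eps He) as [N HN]. exists N; intros; apply HN; auto.
    + exists l. exact Hl.
  - intros x0 x1. exists ((x0 + x1) / 2). intros z. unfold Rdist.
    rewrite !pow2_abs. right; field.
Qed.

(** Induction on the dimension: [phi] selects terms whose first coordinate tends to [l], and the
    remaining coordinates cluster along [phi]. The bound [phi k >= k] is enough for a cluster
    point. *)
Lemma bolzano_weierstrass_Rs (s : nat) (u : nat -> Rs s) :
  (forall n c, 0 <= u n c <= 1) ->
  exists t : Rs s, forall eps N, eps > 0 ->
    exists p, (p >= N)%nat /\ forall c, Rabs (u p c - t c) < eps.
Proof.
  revert u. induction s as [|s IH]; intros u Hu.
  - exists (fun _ => 0). intros eps N _. exists N. split; [lia|]. intros c; inversion c.
  - destruct (Bolzano_Weierstrass (fun n => u n Fin.F1) (fun c => 0 <= c <= 1)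
      (compact_P3 0 1) (fun n => Hu n Fin.F1)) as [l Hl].
    assert (Hphi : forall k, exists p, (p >= k)%nat /\ Rabs (u p Fin.F1 - l) < / INR (S k)).
    { intros k.
      assert (Hk : 0 < / INR (S k)) by (apply Rinv_0_lt_compat, lt_0_INR; lia).
      destruct (Hl (disc l (mkposreal _ Hk)) k) as [p [Hp1 Hp2]].
      - exists (mkposreal _ Hk). intros y Hy; exact Hy.
      - exists p. split; [lia | exact Hp2]. }
    destruct (choice _ Hphi) as [phi Hp].
    destruct (IH (fun k c => u (phi k) (Fin.FS c))) as [t Ht]; [intros; apply Hu|].
    exists (fun c => Fin.caseS' c (fun _ => R) l t).
    intros eps N He.
    destruct (archimed_cor1 eps He) as [N' [HN' HN0]].
    destruct (Ht eps (N + N')%nat He) as [p [Hp1 Hp2]].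
    destruct (Hp p) as [Hp3 Hp4].
    exists (phi p). split; [lia|].
    intros c; pattern c; apply (Fin.caseS' c); [|exact Hp2]. simpl.
    apply Rlt_trans with (1 := Hp4). apply Rle_lt_trans with (2 := HN').
    apply Rinv_le_contravar; [apply lt_0_INR; lia | apply le_INR; lia].
Qed.

Definition unit_box {s : nat} (n : nat) (i : Zs s) : Prop :=
  forall c, (0 <= i c < 2 ^ Z.of_nat n)%Z.

(** Otherwise bad pairs occur at arbitrarily high levels, and their parameters cluster at some [t].
    Continuity at [t] costs 1/4 and convergence 1/8 for each index, so such a pair has distance
    below 3/4. *)
Lemma convergent_uniformly_close {s : nat} (a : Zs s -> R) (supp : list (Zs s))
    {X : Type} (d : X -> X -> R) (x : Zs s -> X) (r : Z) :
  is_metric d -> scheme_convergent a supp d -> bounded_seq d x ->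
  exists N, forall n, (n >= N)%nat -> forall i i' : Zs s, unit_box n i -> close r i i' ->
    d (iter_subdiv a supp d n x i) (iter_subdiv a supp d n x i') < 1.
Proof.
  intros [Hpos [Heq [Hsym Htri]]] Hconv Hb. apply NNPP; intros Hno.
  assert (Hbad : forall N, exists v : nat * (Zs s * Zs s),
    (fst v >= N)%nat /\ unit_box (fst v) (fst (snd v)) /\
    close r (fst (snd v)) (snd (snd v)) /\
    1 <= d (iter_subdiv a supp d (fst v) x (fst (snd v)))
           (iter_subdiv a supp d (fst v) x (snd (snd v)))).
  { intros N. apply NNPP; intros HN. apply Hno. exists N. intros n Hn i i' Hi Hc.
    apply Rnot_le_lt; intros Hle. apply HN. exists (n, (i, i')). simpl; auto. }
  destruct (choice _ Hbad) as [v Hv]. clear Hbad Hno.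
  set (n := fun N => fst (v N)). set (i := fun N => fst (snd (v N))).
  set (i' := fun N => snd (snd (v N))).
  set (dy := fun n (j : Zs s) c => IZR (j c) / 2 ^ n).
  assert (Hp2 : forall m, 0 < 2 ^ m) by (intros; apply pow_lt; lra).
  destruct (bolzano_weierstrass_Rs s (fun N => dy (n N) (i N))) as [t Ht].
  { intros N c. destruct (Hv N) as [_ [Hbox _]]. specialize (Hbox c).
    unfold dy. specialize (Hp2 (n N)). fold (n N) (i N) in Hbox.
    destruct Hbox as [H0 H1]. apply IZR_le in H0. apply IZR_lt in H1.
    rewrite <- pow_IZR in H1. split.
    - unfold Rdiv. apply Rmult_le_pos; auto. left; apply Rinv_0_lt_compat; auto.
    - apply Rmult_le_reg_r with (2 ^ n N); auto.
      replace (IZR (i N c) / 2 ^ n N * 2 ^ n N) with (IZR (i N c)) by (field; lra). lra. }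
  destruct (Hconv x Hb) as [f [Hcont Hlim]].
  destruct (Hcont t (/ 4) ltac:(lra)) as [delta [Hdel Hf]].
  destruct (Hlim (/ 8) ltac:(lra)) as [N1 HN1].
  (* At high levels the parameters of [i] and [i'] differ by less than [delta / 2]; the other half
     of [delta] is spent on approaching [t]. *)
  destruct (geometric_small (/ 2) (IZR (Z.abs r)) (delta / 2)) as [N2 HN2];
    [lra | apply IZR_le; lia | lra |].
  destruct (Ht (delta / 2) (N1 + N2)%nat ltac:(lra)) as [p [Hp Hpt]].
  destruct (Hv p) as [Hn [_ [Hclose Hfar]]].
  fold (n p) (i p) (i' p) in Hn, Hclose, Hfar.
  assert (Hi : d (f (dy (n p) (i p))) (f t) < / 4).
  { apply Hf. intros c. specialize (Hpt c). lra. }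
  assert (Hi' : d (f (dy (n p) (i' p))) (f t) < / 4).
  { apply Hf. intros c. specialize (Hpt c).
    specialize (HN2 (n p) ltac:(lia)). rewrite pow_inv in HN2.
    replace (dy (n p) (i' p) c - t c) with
      (- ((IZR (i p c) - IZR (i' p c)) * / 2 ^ n p) + (dy (n p) (i p) c - t c))
      by (unfold dy; field; specialize (Hp2 (n p)); lra).
    apply Rle_lt_trans with (1 := Rabs_triang _ _).
    rewrite Rabs_Ropp, Rabs_mult, <- minus_IZR, <- abs_IZR.
    assert (Hinv : 0 < / 2 ^ n p) by (apply Rinv_0_lt_compat; auto).
    rewrite (Rabs_right (/ 2 ^ n p)) by lra.
    assert (IZR (Z.abs (i p c - i' p c)) <= IZR (Z.abs r))
      by (apply IZR_le; specialize (Hclose c); lia).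
    nra. }
  assert (H1 := HN1 (n p) ltac:(lia) (i p)). assert (H2 := HN1 (n p) ltac:(lia) (i' p)).
  fold (dy (n p) (i p)) in H1. fold (dy (n p) (i' p)) in H2.
  set (P := iter_subdiv a supp d (n p) x (i p)) in *.
  set (P' := iter_subdiv a supp d (n p) x (i' p)) in *.
  assert (T1 := Htri P (f (dy (n p) (i p))) P').
  assert (T2 := Htri (f (dy (n p) (i p))) (f t) P').
  assert (T3 := Htri (f t) (f (dy (n p) (i' p))) P').
  rewrite (Hsym P (f _)) in T1. rewrite (Hsym (f t) (f (dy (n p) (i' p)))) in T3. lra.
Qed.

(** The errors add up to [M * (1 + 2 + ... + 2 ^ (n - 1))]. Hence ancestors of indices in the unit
    box lie in a box independent of [n]. *)
Lemma ancestor_bound {s : nat} (a : Zs s -> R) (M : Z) :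
  (forall i j, parent a i j -> forall c, (Z.abs (i c - 2 * j c) <= M)%Z) ->
  forall n i j, ancestor a n i j ->
  forall c, (Z.abs (i c - 2 ^ Z.of_nat n * j c) <= (2 ^ Z.of_nat n - 1) * M)%Z.
Proof.
  intros HM. induction n as [|n IH]; intros i j H c.
  - simpl in H. subst j. change (2 ^ Z.of_nat 0)%Z with 1%Z. lia.
  - destruct H as [i1 [H1 H2]]. specialize (IH _ _ H2 c). specialize (HM _ _ H1 c).
    rewrite Nat2Z.inj_succ, Z.pow_succ_r by lia.
    set (q := (2 ^ Z.of_nat n)%Z) in *.
    replace (2 * q * j c)%Z with (2 * (q * j c))%Z by ring.
    replace ((2 * q - 1) * M)%Z with (M + 2 * ((q - 1) * M))%Z by ring. lia.
Qed.

(** The mask sees only [i - 2 * j], so the walk commutes with these translations; this reduces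
    arbitrary indices to the unit box. *)
Lemma ancestor_shift {s : nat} (a : Zs s -> R) (q : Zs s) :
  forall n i j, ancestor a n i j ->
  ancestor a n (fun c => i c + 2 ^ Z.of_nat n * q c)%Z (fun c => j c + q c)%Z.
Proof.
  induction n as [|n IH]; intros i j H.
  - simpl in H. subst j. apply functional_extensionality. intros c.
    change (2 ^ Z.of_nat 0)%Z with 1%Z. ring.
  - destruct H as [i1 [H1 H2]].
    exists (fun c => i1 c + 2 ^ Z.of_nat n * q c)%Z. split; [|apply IH; auto].
    unfold parent in *. replace (mask_arg _ _) with (mask_arg i i1); auto.
    extensionality c. unfold mask_arg.
    rewrite Nat2Z.inj_succ, Z.pow_succ_r by lia. ring.
Qed.

Lemma finite_interval_Z (L : nat) :
  exists l : list Z, forall z, (Z.abs z <= Z.of_nat L)%Z -> In z l.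
Proof.
  induction L as [|L [l Hl]].
  - exists (0%Z :: nil). intros z Hz. left. lia.
  - exists (Z.of_nat (S L) :: (- Z.of_nat (S L))%Z :: l). intros z Hz. simpl In.
    destruct (Z.eq_dec z (Z.of_nat (S L))); auto.
    destruct (Z.eq_dec z (- Z.of_nat (S L))); auto.
    right; right. apply Hl. lia.
Qed.

Lemma finite_box (s : nat) (L : Z) :
  exists l : list (Zs s), forall j, (forall c, (Z.abs (j c) <= L)%Z) -> In j l.
Proof.
  destruct (finite_interval_Z (Z.to_nat L)) as [lz Hlz].
  induction s as [|s [l Hl]].
  - exists ((fun _ => 0%Z) :: nil). intros j _. left. extensionality c. inversion c.
  - exists (flat_map (fun z => map (fun t c => Fin.caseS' c (fun _ => Z) z t) l) lz).
    intros j Hj. apply in_flat_map. exists (j Fin.F1). split.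
    + apply Hlz. specialize (Hj Fin.F1). lia.
    + apply in_map_iff. exists (fun c => j (Fin.FS c)). split.
      * extensionality c. pattern c; apply (Fin.caseS' c); reflexivity.
      * apply Hl. intros c; apply Hj.
Qed.

(** Finitely many test sequences then suffice, which permits one level [N] for all of them. *)
Lemma finite_powerset {A : Type} (l : list A) :
  exists LP : list (A -> Prop), forall P : A -> Prop,
    exists Q, In Q LP /\ forall j, In j l -> (Q j <-> P j).
Proof.
  induction l as [|b l [LP HLP]].
  - exists ((fun _ => True) :: nil). intros P. exists (fun _ => True). split; simpl; tauto.
  - exists (map (fun Q j => Q j \/ j = b) LP ++ map (fun Q j => Q j /\ j <> b) LP).
    intros P. destruct (HLP P) as [Q [HQ1 HQ2]].
    destruct (classic (P b)) as [Hb|Hb].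
    + exists (fun j => Q j \/ j = b). split.
      * apply in_or_app; left. apply in_map_iff. exists Q; auto.
      * intros j [->|Hj]; [tauto|]. rewrite (HQ2 j Hj).
        split; [intros [h| ->]; auto | auto].
    + exists (fun j => Q j /\ j <> b). split.
      * apply in_or_app; right. apply in_map_iff. exists Q; auto.
      * intros j [->|Hj]; [tauto|]. rewrite (HQ2 j Hj).
        split; [tauto | intros h; split; auto; intros ->; auto].
Qed.

Lemma eventually_forall_list {A : Type} (l : list A) (P : A -> nat -> Prop) :
  (forall q, In q l -> exists N, forall n, (n >= N)%nat -> P q n) ->
  exists N, forall q, In q l -> forall n, (n >= N)%nat -> P q n.
Proof.
  induction l as [|b l IH]; intros H.
  - exists O. intros q [].
  - destruct IH as [N1 HN1]; [intros; apply H; right; auto|].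
    destruct (H b) as [N2 HN2]; [left; auto|].
    exists (N1 + N2)%nat. intros q [->|Hq] n Hn; [apply HN2; lia | apply HN1; auto; lia].
Qed.

Definition indicator {A : Type} (P : A -> Prop) (j : A) : R :=
  if excluded_middle_informative (P j) then 1 else 0.

(** If the ancestors of [i] and [i'] were disjoint, the indicator of those of [i] would produce the
    values 1 and 0 at these indices, against uniform closeness. *)
Lemma convergent_common_ancestor {s : nat} (a : Zs s -> R) (supp : list (Zs s)) (r : Z) :
  is_mask a supp -> scheme_convergent a supp Rdist ->
  exists N, (1 <= N)%nat /\ forall i i', close r i i' ->
    exists j, ancestor a N i j /\ ancestor a N i' j.
Proof.
  intros Hm Hconv.
  destruct (mask_bound_exists a supp Hm) as [M [HM1 HM]].
  destruct (finite_box s (M + 1)) as [l Hl].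
  destruct (finite_powerset l) as [LP HLP].
  (* Intersecting with [l] discards the indices where [Q] need not agree with the set it
     represents. *)
  set (chi := fun Q : Zs s -> Prop => indicator (fun j => Q j /\ In j l)).
  destruct (eventually_forall_list LP (fun Q n => forall i i' : Zs s,
    unit_box n i -> close r i i' ->
    Rdist (iter_subdiv a supp Rdist n (chi Q) i)
          (iter_subdiv a supp Rdist n (chi Q) i') < 1)) as [N HN].
  { intros Q _. apply convergent_uniformly_close; auto; [apply hadamard_R|].
    exists 1. intros i j. unfold chi, indicator, Rdist.
    do 2 destruct excluded_middle_informative; apply Rabs_le; lra. }
  assert (Hbox : forall i i' : Zs s, unit_box (S N) i -> close r i i' ->
    exists j, ancestor a (S N) i j /\ ancestor a (S N) i' j).
  { intros i i' Hi Hc. apply NNPP; intros Hno.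
    destruct (HLP (ancestor a (S N) i)) as [Q [HQ1 HQ2]].
    assert (HN' := HN Q HQ1 (S N) ltac:(lia) i i' Hi Hc).
    rewrite (iter_subdiv_const a supp Rdist (chi Q) 1 Hm hadamard_R) in HN'.
    rewrite (iter_subdiv_const a supp Rdist (chi Q) 0 Hm hadamard_R) in HN'.
    - unfold Rdist in HN'. rewrite Rabs_right in HN'; lra.
    - intros j Hj. unfold chi, indicator.
      destruct excluded_middle_informative as [[h1 h2]|]; auto.
      exfalso. apply Hno. exists j. split; auto. apply HQ2; auto.
    - intros j Hj. unfold chi, indicator.
      destruct excluded_middle_informative as [|h]; auto.
      exfalso. apply h.
      assert (In j l); [|split; auto; apply HQ2; auto].
      apply Hl. intros c. assert (H := ancestor_bound a M HM _ _ _ Hj c).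
      specialize (Hi c). set (q := (2 ^ Z.of_nat (S N))%Z) in *. nia. }
  exists (S N). split; [lia|]. intros i i' Hc.
  set (q := (2 ^ Z.of_nat (S N))%Z). assert (Hq : (0 < q)%Z) by (apply Z.pow_pos_nonneg; lia).
  (* Both indices are moved by the same multiple of [q], which brings [i] into the unit box and
     keeps the difference. *)
  destruct (Hbox (fun c => i c mod q)%Z (fun c => i' c - q * (i c / q))%Z) as [j [H1 H2]].
  - intros c. apply Z.mod_pos_bound; auto.
  - intros c. specialize (Hc c). rewrite Z.mod_eq by lia.
    replace (i c - q * (i c / q) - (i' c - q * (i c / q)))%Z with (i c - i' c)%Z by ring. auto.
  - apply (ancestor_shift a (fun c => i c / q)%Z) in H1, H2. fold q in H1, H2.
    exists (fun c => j c + i c / q)%Z. split.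
    + replace i with (fun c => i c mod q + q * (i c / q))%Z at 1; auto.
      extensionality c. rewrite Z.mod_eq by lia. ring.
    + replace i' with (fun c => i' c - q * (i c / q) + q * (i c / q))%Z; auto.
      extensionality c. ring.
Qed.

(** * Uniform contraction by coupling *)

Lemma iter_subdiv_close_le {s : nat} (a : Zs s -> R) (supp : list (Zs s)) (M : Z)
    {X : Type} (d : X -> X -> R) (x : Zs s -> X) (B : R) :
  is_mask a supp -> is_hadamard d ->
  (forall i j, parent a i j -> forall c, (Z.abs (i c - 2 * j c) <= M)%Z) ->
  (forall i i', close (2 * M) i i' -> d (x i) (x i') <= B) ->
  forall n i i', close (2 * M) i i' ->
    d (iter_subdiv a supp d n x i) (iter_subdiv a supp d n x i') <= B.
Proof.
  intros Hm Hd HM HB. induction n as [|n IH]; intros i i' Hc; simpl; auto.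
  apply subdiv_dist2_le; auto. intros j j' Hj Hj'. apply IH.
  apply parent_close with a i i'; auto.
Qed.

(* The product coupling of the two backward random walks [i -> j] with probability
   [a (i - 2 j)] meets at [j] with probability at least [alpha ^ (2 n)]. *)
Lemma iter_subdiv_common_ancestor {s : nat} (a : Zs s -> R) (supp : list (Zs s)) (M : Z)
    (alpha : R) {X : Type} (d : X -> X -> R) (x : Zs s -> X) (B : R) :
  is_mask a supp -> is_hadamard d -> 0 < alpha ->
  (forall i j, parent a i j -> alpha <= a (mask_arg i j)) ->
  (forall i j, parent a i j -> forall c, (Z.abs (i c - 2 * j c) <= M)%Z) ->
  0 <= B -> (forall i i', close (2 * M) i i' -> d (x i) (x i') <= B) ->
  forall n i i' j, close (2 * M) i i' -> ancestor a n i j -> ancestor a n i' j ->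
    d (iter_subdiv a supp d n x i) (iter_subdiv a supp d n x i')
      <= B - alpha ^ (2 * n) * B.
Proof.
  intros Hm Hd Ha Hal HM HB0 HB.
  assert (Hd' := Hd). destruct Hd' as [[Hpos [Heq [Hsym _]]] _].
  induction n as [|n IH]; intros i i' j Hc Hi Hi'.
  - simpl in *. subst i i'. right. rewrite (proj2 (Heq _ _) eq_refl). ring.
  - destruct Hi as [k [Hk1 Hk2]]. destruct Hi' as [k' [Hk1' Hk2']]. simpl iter_subdiv.
    assert (Hn := iter_subdiv_close_le a supp M d x B Hm Hd HM HB n).
    set (y := iter_subdiv a supp d n x) in *.
    set (e := alpha ^ (2 * n) * B) in *.
    assert (He : 0 <= e) by (apply Rmult_le_pos; auto; apply pow_le; lra).
    assert (Hkk : forall h h', parent a i h -> parent a i' h' -> d (y h) (y h') <= B).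
    { intros h h' Hh Hh'. apply Hn. apply parent_close with a i i'; auto. }
    (* The two walks advance one after the other: first [i'] against the fixed point [y k], then
       [i]. Each move keeps at least a fraction [alpha] of the gain [e]. *)
    assert (Hin : d (subdiv a supp d y i') (y k) <= B - alpha * e).
    { apply Rle_trans with (B - a (mask_arg i' k') * e).
      - apply subdiv_dist_le_gap; auto.
        + intros h Hh. rewrite Hsym. auto.
        + rewrite Hsym. apply (IH k k' j); auto. apply parent_close with a i i'; auto.
      - specialize (Hal _ _ Hk1'). nra. }
    replace (alpha ^ (2 * S n)) with (alpha * (alpha * alpha ^ (2 * n)))
      by (replace (2 * S n)%nat with (S (S (2 * n))) by lia; simpl; ring).
    apply Rle_trans with (B - a (mask_arg i k) * (alpha * e)).
    + apply subdiv_dist_le_gap; auto.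
      * intros h Hh. rewrite Hsym. apply subdiv_dist_le; auto.
        intros h' Hh'. rewrite Hsym. auto.
      * rewrite Hsym. exact Hin.
    + specialize (Hal _ _ Hk1). assert (0 <= alpha * e) by nra.
      unfold e in *. nra.
Qed.

Lemma bernoulli (h : R) (n : nat) : 0 <= h <= 1 -> 1 - INR n * h <= (1 - h) ^ n.
Proof.
  intros Hh. induction n as [|n IH]; [simpl; lra|].
  rewrite S_INR. simpl. assert (H := pos_INR n).
  assert (0 <= (1 - h) * ((1 - h) ^ n - (1 - INR n * h))) by (apply Rmult_le_pos; lra).
  assert (0 <= INR n * (h * h)) by (apply Rmult_le_pos; nra). nra.
Qed.

Lemma convergent_R_geometric_contraction {s : nat} (a : Zs s -> R) (supp : list (Zs s)) :
  is_mask a supp -> scheme_convergent a supp Rdist ->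
  exists C gamma : R, 0 <= C /\ gamma < 1 /\
    forall (X : Type) (d : X -> X -> R), is_hadamard d ->
      forall x : Zs s -> X, bounded_seq d x -> forall n : nat,
        Dinf d (iter_subdiv a supp d n x) <= C * gamma ^ n * Dinf d x.
Proof.
  intros Hm Hconv.
  destruct (mask_bound_exists a supp Hm) as [M [HM1 HM]].
  destruct (mask_min_exists a supp Hm) as [alpha [Ha Hal]].
  destruct (convergent_common_ancestor a supp (2 * M) Hm Hconv) as [N [HN1 HN]].
  (* In place of an [N]-th root of [1 - alpha ^ (2 * N)], Bernoulli's inequality gives the explicit
     [gamma = 1 - delta / N] with [gamma ^ N >= 1 - delta]. Halving keeps [gamma >= / 2]. *)
  set (delta := alpha ^ (2 * N) / 2).
  assert (Hdel : 0 < delta <= / 2).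
  { unfold delta. assert (0 < alpha ^ (2 * N)) by (apply pow_lt; lra).
    assert (alpha ^ (2 * N) <= 1) by (rewrite <- (pow1 (2 * N)); apply pow_incr; lra). lra. }
  assert (HNR : 1 <= INR N) by (apply (le_INR 1); auto).
  set (h := delta / INR N).
  assert (HhN : INR N * h = delta) by (unfold h; field; lra).
  assert (Hh : 0 < h <= / 2).
  { split; [apply Rdiv_lt_0_compat; lra|]. nra. }
  set (gamma := 1 - h).
  assert (HgN : 1 - alpha ^ (2 * N) <= gamma ^ N).
  { apply Rle_trans with (1 - INR N * h); [|apply bernoulli; lra].
    rewrite HhN. unfold delta in *. lra. }
  assert (Hgp : forall n, 0 < gamma ^ n) by (intros; apply pow_lt; unfold gamma; lra).
  (* This factor absorbs the fewer than [N] steps left over after blocks of length [N]. *)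
  set (K := / gamma ^ N).
  assert (HK : 0 < K) by (apply Rinv_0_lt_compat; auto).
  assert (Hdecay : forall (X : Type) (d : X -> X -> R), is_hadamard d ->
    forall n x B, 0 <= B -> (forall i i', close (2 * M) i i' -> d (x i) (x i') <= B) ->
    forall i i', close (2 * M) i i' ->
    d (iter_subdiv a supp d n x i) (iter_subdiv a supp d n x i') <= K * gamma ^ n * B).
  { intros X d Hd n. induction n as [n IH] using lt_wf_ind. intros x B HB0 HB i i' Hc.
    destruct (Nat.lt_ge_cases n N) as [Hlt|Hge].
    - apply Rle_trans with B; [apply iter_subdiv_close_le with M; auto|].
      assert (1 <= K * gamma ^ n); [|nra].
      replace 1 with (K * gamma ^ N) by (unfold K; field; apply Rgt_not_eq, Hgp).
      apply Rmult_le_compat_l; [lra|].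
      replace N with (n + (N - n))%nat by lia. rewrite pow_add.
      assert (gamma ^ (N - n) <= 1)
        by (rewrite <- (pow1 (N - n)); apply pow_incr; unfold gamma; lra).
      specialize (Hgp n). nra.
    - replace n with (N + (n - N))%nat at 1 2 by lia.
      unfold iter_subdiv. rewrite Nat.iter_add.
      fold (iter_subdiv a supp d (n - N) x). set (y := iter_subdiv a supp d (n - N) x).
      fold (iter_subdiv a supp d N y).
      destruct (HN i i' Hc) as [j [Hj Hj']].
      assert (HB' : 0 <= K * gamma ^ (n - N) * B).
      { repeat apply Rmult_le_pos; auto; left; auto. }
      apply Rle_trans with (K * gamma ^ (n - N) * B
        - alpha ^ (2 * N) * (K * gamma ^ (n - N) * B)).
      + apply iter_subdiv_common_ancestor with M j; auto; [lra|].
        intros k k' Hk. apply IH; auto. lia.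
      + replace (gamma ^ n) with (gamma ^ N * gamma ^ (n - N))
          by (rewrite <- pow_add; f_equal; lia).
        nra. }
  (* Passing from adjacent indices to the radius [2 * M] costs the factor [2 * M]. *)
  exists (K * INR (Z.to_nat (2 * M))), gamma.
  split; [apply Rmult_le_pos; [lra | apply pos_INR]|].
  split; [unfold gamma; lra|].
  intros X d Hd x Hb n. apply Dinf_le; [apply bounded_iter_subdiv; auto|].
  intros i j Hij.
  replace (K * INR (Z.to_nat (2 * M)) * gamma ^ n * Dinf d x) with
    (K * gamma ^ n * (INR (Z.to_nat (2 * M)) * Dinf d x)) by ring.
  apply Hdecay; auto.
  - apply Rmult_le_pos; [apply pos_INR | apply Dinf_nonneg; auto; apply Hd].
  - intros k k' Hk. apply dist_close_le; auto; [apply Hd|].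
    rewrite Z2Nat.id by lia. exact Hk.
  - intros c. specialize (Hij c). lia.
Qed.

Theorem mainTheorem7 (s : nat) (a : Zs s -> R) (supp : list (Zs s))
  (Hmask : is_mask a supp) :
  (forall (X : Type) (d : X -> X -> R), is_hadamard d -> scheme_convergent a supp d)
  <->
  (exists C gamma : R, 0 <= C /\ gamma < 1 /\
     forall (X : Type) (d : X -> X -> R), is_hadamard d ->
       forall x : Zs s -> X, bounded_seq d x ->
         forall n : nat,
           Dinf d (iter_subdiv a supp d n x) <= C * gamma ^ n * Dinf d x).
Proof.
  split.
  - intros H. apply convergent_R_geometric_contraction; auto using hadamard_R.
  - intros [C [gamma [HC [Hg H]]]] X d Hd.
    apply geometric_contraction_convergent with C gamma; auto.
Qed.
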